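(* Let $H:\mathcal{F}\to\mathbb{R}$ be a sublinear function, i.e. $H(\lambda\eta)=\lambda H(\eta)$ for all $\lambda>0$, $\eta\in\mathcal{F}$, and $H(\eta+\mu)\le H(\eta)+H(\mu)$ for all $\eta,\mu\in\mathcal{F}$. Then the set $$K=\{x\in\mathbb{R}^{d+1}:\ \langle x,\eta\rangle_-\le H(\eta)\ \ \forall\eta\in\mathcal{F}\}$$ is an F-convex set, and $H$ is its extended support function.
   Context: Minkowski space is $\mathbb{R}^{d+1}$ ($d\ge1$) with $\langle x,y\rangle_-=x_1y_1+\cdots+x_dy_d-x_{d+1}y_{d+1}$; $\mathcal{F}=\{x:\langle x,x\rangle_-<0,\ x_{d+1}>0\}$ is the set of future time-like vectors. F-convex set: a (nonempty) proper closed convex set $K\subset\mathbb{R}^{d+1}$ which is the intersection of the future sides of space-like hyperplanes (sets $\{x:\langle x,\eta\rangle_-\le\alpha\}$ with $\eta\in\mathcal{F}$, $\alpha\in\mathbb{R}$) and such that for every $\eta\in\mathcal{F}$ there is $\alpha\in\mathbb{R}$ with $\langle\eta,k\rangle_-\le\alpha$ for all $k\in K$. Its extended support function is $H_K:\mathcal{F}\to\mathbb{R}$, $H_K(\eta)=\sup\{\langle k,\eta\rangle_-:k\in K\}$. *)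

(* Defs.v *)
From HB Require Import structures.
From mathcomp Require Import all_boot all_order all_algebra.
From mathcomp Require Import all_classical all_reals all_analysis.

Set Implicit Arguments.
Unset Strict Implicit.
Unset Printing Implicit Defensive.

Import Order.TTheory GRing.Theory Num.Theory.
Import numFieldNormedType.Exports.

Local Open Scope classical_set_scope.
Local Open Scope ring_scope.

(* Coordinates x_1, ..., x_d are the entries of index 0, ..., d-1, and the
   time coordinate x_(d+1) is the entry of index ord_max. *)
Definition mink (R : realType) (d : nat) (x y : 'rV[R]_d.+1) : R :=
  \sum_(i < d) x ord0 (widen_ord (leqnSn d) i) * y ord0 (widen_ord (leqnSn d) i)
  - x ord0 ord_max * y ord0 ord_max.

Definition future_timelike (R : realType) (d : nat) : set 'rV[R]_d.+1 :=
  [set x | mink x x < 0 /\ 0 < x ord0 ord_max].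
Arguments future_timelike {R d}.

Definition future_side (R : realType) (d : nat) (eta : 'rV[R]_d.+1) (alpha : R) :
    set 'rV[R]_d.+1 :=
  [set x | mink x eta <= alpha].

(* [A] is the family of space-like hyperplanes, given by pairs (eta, alpha). *)
Definition inter_future_sides (R : realType) (d : nat) (K : set 'rV[R]_d.+1) :
    Prop :=
  exists A : set ('rV[R]_d.+1 * R),
    (forall p, A p -> future_timelike p.1) /\
    K = \bigcap_(p in A) future_side p.1 p.2.

Record F_convex (R : realType) (d : nat) (K : set 'rV[R]_d.+1) : Prop := {
  F_convex_nonempty : K !=set0;
  F_convex_proper : K <> setT;
  F_convex_closed : closed K;
  F_convex_convex : convex_set (K : set (convex_lmodType 'rV[R]_d.+1));
  F_convex_inter : inter_future_sides K;
  F_convex_bounded : forall eta, future_timelike eta ->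
    exists alpha : R, forall k, K k -> mink eta k <= alpha
}.

(* [sup] is 0 on sets without a supremum; when [K] is F-convex and [eta] is
   future time-like, the set below is nonempty and bounded above. *)
Definition ext_support (R : realType) (d : nat) (K : set 'rV[R]_d.+1)
    (eta : 'rV[R]_d.+1) : R :=
  sup [set mink k eta | k in K].

(* A function on future time-like vectors is encoded by a total function whose
   values elsewhere are irrelevant. *)
Definition sublinear_on_future (R : realType) (d : nat) (H : 'rV[R]_d.+1 -> R) :
    Prop :=
  (forall (lambda : R) eta, 0 < lambda -> future_timelike eta ->
     H (lambda *: eta) = lambda * H eta) /\
  (forall eta mu, future_timelike eta -> future_timelike mu ->
     H (eta + mu) <= H eta + H mu).

(* Main.v *)
Require Import Defs.
From mathcomp Require Import all_boot all_order all_algebra.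
From mathcomp Require Import all_classical all_reals all_analysis.
From mathcomp Require Import ring lra.
Import Order.TTheory GRing.Theory Num.Theory.
Import numFieldNormedType.Exports.

Local Open Scope classical_set_scope.
Local Open Scope ring_scope.

(** The theorem rests on touching points: for every [eta0] in the future cone F
    there is [x] with [mink x eta <= H eta] on F and equality at [eta0]. They
    show that K is nonempty and that the supremum of [mink k eta0] over K is
    attained with value [H eta0]. The other clauses say that K is an
    intersection of closed half-spaces bounded by space-like hyperplanes.

    Since [mink] is nondegenerate, a touching point amounts to a linear form
    below [H] on F that agrees with [H] at [eta0]: a supporting hyperplane at a
    point of the open cone F. Both halves of its construction use one
    operation. For [p] sublinear on a convex cone C having [e] as an interior
    point, let
      p'(v) = inf over s with v + s e in C of p(v + s e) - s p(e).
    As [e] is interior, both [v] and [- v] enter C when shifted along [e], and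
    subadditivity then keeps this infimum finite for every [v], so p' is sublinear on the whole space; it
    lies below [p] on C, and p'(-e) <= -p(e). With C = F and e = eta0 this
    replaces [H] by an everywhere defined sublinear function for which any
    minorizing linear form must take the value [H eta0] at [eta0]. With C the
    whole space, applied to the vectors of a basis in turn, it yields a
    sublinear function that is linear along each axis, hence dominates a
    linear form: the finite-dimensional Hahn-Banach theorem.

    The geometry of F enters through two facts: F is closed under addition,
    by the reversed Cauchy-Schwarz inequality, and every vector enters F once
    a large multiple of a given element of F is added to it. *)

(** * Linearizing a sublinear function along a vector *)

(** The condition on [s] says that [e] is an algebraic interior point of C: up
    to a positive factor, [v + s *: e] with [s] large is a small perturbation of
    [e]. *)
Definition absorbing_cone {R : realType} {V : lmodType R} (C : set V) (e : V) :
    Prop :=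
  [/\ C e,
      forall c v, 0 < c -> C v -> C (c *: v),
      forall u v, C u -> C v -> C (u + v) &
      forall v, exists s : R, C (v + s *: e)].

Definition sublinear_on {R : realType} {V : lmodType R} (C : set V)
    (p : V -> R) : Prop :=
  (forall c v, 0 < c -> C v -> p (c *: v) = c * p v) /\
  (forall u v, C u -> C v -> p (u + v) <= p u + p v).

Lemma absorbing_coneT {R : realType} {V : lmodType R} (e : V) :
  absorbing_cone [set: V] e.
Proof. by split=> // v; exists 0. Qed.

(** Directional derivative of [p] at [e]: for [s > 0] and
    [t = s^-1], homogeneity turns the quantities into the difference quotients
    [(p (e + t v) - p e) / t]. They decrease in [s] by subadditivity, so the
    other admissible [s] do not change the infimum. The form with [s] avoids
    divisions and allows the value [s = 0]. *)
Definition linearize {R : realType} {V : lmodType R} (C : set V) (e : V)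
    (p : V -> R) (v : V) : R :=
  inf [set p (v + s *: e) - s * p e | s in [set s | C (v + s *: e)]].

(** On a line through the origin a sublinear function is convex and
    homogeneous, so its slope at [e] bounds it from below even at negative
    multiples of [e] that belong to C. *)
Lemma sublinear_on_line_ge {R : realType} {V : lmodType R} {C : set V} {e : V}
    {p : V -> R} (c : R) :
  sublinear_on C p -> absorbing_cone C e -> C (c *: e) -> c * p e <= p (c *: e).
Proof.
move=> [pZ pD] [Ce CZ _ _] Cce.
(* Any positive m with m + c > 0 works: compare p at (m + c) e and at m e. *)
pose m := `|c| + 1.
have m0 : 0 < m by rewrite /m ltr_wpDl.
have mc0 : 0 < m + c by rewrite /m; have := ler_norm (- c); rewrite normrN; lra.
have := pD _ _ (CZ m _ m0 Ce) Cce.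
rewrite -scalerDl (pZ (m + c))// (pZ m)//; lra.
Qed.

(** Adding a translate of [- v] that lies in C returns to the line spanned by
    [e], where [p] is bounded below. *)
Lemma linearize_has_lbound {R : realType} {V : lmodType R} {C : set V} {e : V}
    {p : V -> R} (v : V) :
  sublinear_on C p -> absorbing_cone C e ->
  has_lbound [set p (v + s *: e) - s * p e | s in [set s | C (v + s *: e)]].
Proof.
move=> slp aC; have [_ _ CD Ca] := aC.
have [t Ct] := Ca (- v).
exists (t * p e - p (- v + t *: e)) => _ [s /= Cs <-].
have stE : (v + s *: e) + (- v + t *: e) = (s + t) *: e.
  by rewrite addrACA subrr add0r scalerDl.
have := slp.2 _ _ Cs Ct.
have := CD _ _ Cs Ct; rewrite stE => /(sublinear_on_line_ge _ slp aC); lra.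
Qed.

Lemma linearize_le {R : realType} {V : lmodType R} {C : set V} {e : V}
    {p : V -> R} (v : V) (s : R) :
  sublinear_on C p -> absorbing_cone C e -> C (v + s *: e) ->
  linearize C e p v <= p (v + s *: e) - s * p e.
Proof.
move=> slp aC Cs; apply: ge_inf; first exact: linearize_has_lbound.
by exists s.
Qed.

Lemma linearize_ge {R : realType} {V : lmodType R} {C : set V} {e : V}
    {p : V -> R} (v : V) (x : R) : absorbing_cone C e ->
  (forall s, C (v + s *: e) -> x <= p (v + s *: e) - s * p e) ->
  x <= linearize C e p v.
Proof.
move=> [_ _ _ Ca] xle; apply: lb_le_inf.
  by have [s Cs] := Ca v; exists (p (v + s *: e) - s * p e), s.
by move=> _ [s /= Cs <-]; exact: xle.
Qed.

Lemma linearize_sublinear {R : realType} {V : lmodType R} {C : set V} {e : V}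
    {p : V -> R} : sublinear_on C p -> absorbing_cone C e ->
  sublinear_on [set: V] (linearize C e p).
Proof.
move=> slp aC; have [Ce CZ CD Ca] := aC; have [pZ pD] := slp.
have scale_le c v : 0 < c -> c * linearize C e p v <= linearize C e p (c *: v).
  move=> c0; apply: linearize_ge => // s Cs.
  (* Shifting c v by s e is c times shifting v by (s / c) e. *)
  have c_neq0 := lt0r_neq0 c0.
  have cE : c *: v + s *: e = c *: (v + (c^-1 * s) *: e).
    by rewrite scalerDr scalerA mulVKf.
  have Cs' : C (v + (c^-1 * s) *: e).
    by have := CZ c^-1 _ _ Cs; rewrite cE scalerA mulVf// scale1r invr_gt0; apply.
  rewrite cE pZ// -ler_pdivlMl// mulrBr mulKf// mulrA.
  exact: linearize_le.
split=> [c v c0 _|u v _ _].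
  apply/eqP; rewrite eq_le scale_le// andbT.
  (* The converse inequality is [scale_le] for the inverse factor. *)
  rewrite -ler_pdivrMl// -[in leRHS](scalerK (lt0r_neq0 c0) v).
  by apply: scale_le; rewrite invr_gt0.
rewrite -lerBlDr; apply: linearize_ge => // s Cs.
rewrite lerBlDr -lerBlDl; apply: linearize_ge => // t Ct.
rewrite lerBlDl.
have stE : (u + v) + (s + t) *: e = (u + s *: e) + (v + t *: e).
  by rewrite scalerDl addrACA.
have Cst : C (u + v + (s + t) *: e) by rewrite stE; exact: CD.
have := linearize_le _ _ slp aC Cst; have := pD _ _ Cs Ct; rewrite stE; lra.
Qed.

Lemma linearize_le_id {R : realType} {V : lmodType R} {C : set V} {e : V}
    {p : V -> R} (v : V) : sublinear_on C p -> absorbing_cone C e -> C v ->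
  linearize C e p v <= p v.
Proof.
move=> slp aC Cv.
have := @linearize_le _ _ _ _ _ v 0 slp aC.
by rewrite scale0r mul0r addr0 subr0; apply.
Qed.

(** The shift [s = 2] moves [- e] to [e]. Together with [linearize_le_id] this
    makes the linearization linear along [e], with slope [p e]. *)
Lemma linearize_opp {R : realType} {V : lmodType R} {C : set V} {e : V}
    {p : V -> R} : sublinear_on C p -> absorbing_cone C e ->
  linearize C e p (- e) <= - p e.
Proof.
move=> slp aC; have [Ce _ _ _] := aC.
have := @linearize_le _ _ _ _ _ (- e) 2 slp aC.
have -> : - e + 2 *: e = e by rewrite scaler_nat mulr2n addKr.
move=> /(_ Ce); lra.
Qed.

(** * The finite-dimensional Hahn-Banach theorem *)

(** Linearity along a vector is inherited by every smaller sublinear function,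
    so linearizing along the vectors one after the other loses nothing. *)
Lemma sublinear_minorant_linear_on_seq {R : realType} {V : lmodType R}
    (es : seq V) (p : V -> R) : sublinear_on [set: V] p ->
  exists q, [/\ sublinear_on [set: V] q, (forall v, q v <= p v) &
                forall e, e \in es -> q (- e) <= - q e].
Proof.
elim: es p => [|e es IH] p slp; first by exists p.
have aT := absorbing_coneT e.
have [q [slq qle qes]] := IH _ (linearize_sublinear slp aT).
exists q; split=> // [v|f].
  by apply: le_trans (qle v) _; exact: linearize_le_id.
rewrite inE => /orP[/eqP->|/qes//].
have := qle (- e); have := qle e; have := linearize_opp slp aT.
have := linearize_le_id e slp aT I; lra.
Qed.

(** A sublinear [q] below [p] with [q (- e) <= - q e] on the axes is dominated
    by the linear form with the same values on the axes; evaluated at [- v],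
    this gives the lower bound on [q v]. *)
Lemma hahn_banach_rV {R : realType} {n : nat} (p : 'rV[R]_n -> R) :
  sublinear_on [set: 'rV[R]_n] p ->
  exists c : 'I_n -> R, forall v : 'rV[R]_n, \sum_i v ord0 i * c i <= p v.
Proof.
move=> /(sublinear_minorant_linear_on_seq [seq delta_mx ord0 i | i <- enum 'I_n]).
move=> [q [[qZ qD] qle qN]].
exists (fun i => q (delta_mx ord0 i)) => v; apply: le_trans (qle v).
have q0 : q 0 = 0.
  by have := qZ 2 0 (ltr0Sn _ _) I; rewrite scaler0; lra.
have qZ_le c i : q (c *: delta_mx ord0 i) <= c * q (delta_mx ord0 i).
  have [c0|c0|->] := ltgtP c 0; last by rewrite scale0r q0 mul0r.
    rewrite -[c]opprK scaleNr -scalerN qZ ?oppr_gt0//.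
    rewrite [leRHS]mulNr -mulrN ler_pM2l ?oppr_gt0//.
    by apply: qN; apply: map_f; rewrite mem_enum.
  by rewrite qZ.
have qNv : q (- v) <= - \sum_i v ord0 i * q (delta_mx ord0 i).
  rewrite {1}[v]row_sum_delta -!sumrN.
  apply: (big_ind2 (fun x y => q x <= y)) => [|x a y b qx qy|i _].
  - by rewrite q0.
  - by apply: le_trans (qD x y I I) _; exact: lerD.
  - by rewrite -scaleNr -mulNr; exact: qZ_le.
have := qD v (- v) I I; rewrite subrr q0; lra.
Qed.

(** * The future cone *)

Lemma minkC {R : realType} {d : nat} (x y : 'rV[R]_d.+1) : mink x y = mink y x.
Proof.
rewrite /mink mulrC; congr (_ - _); apply: eq_bigr => i _; exact: mulrC.
Qed.

Lemma mink_linear {R : realType} {d : nat} (a b : R) (x y z : 'rV[R]_d.+1) :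
  mink (a *: x + b *: y) z = a * mink x z + b * mink y z.
Proof.
rewrite /mink !mulrBr !mulr_sumr addrACA -big_split !mxE /=.
by congr (_ + _); [apply: eq_bigr => i _; rewrite !mxE; ring | ring].
Qed.

Lemma mink_sqr {R : realType} {d : nat} (a b : R) (x y : 'rV[R]_d.+1) :
  mink (a *: x + b *: y) (a *: x + b *: y) =
  a ^+ 2 * mink x x + 2 * a * b * mink x y + b ^+ 2 * mink y y.
Proof.
rewrite mink_linear !(minkC _ (a *: x + b *: y)) !mink_linear (minkC y x).
by ring.
Qed.

Lemma mink_ge0 {R : realType} {d : nat} (x : 'rV[R]_d.+1) :
  x ord0 ord_max = 0 -> 0 <= mink x x.
Proof.
move=> x0; rewrite /mink x0 mul0r subr0.
by apply: sumr_ge0 => i _; rewrite -expr2 sqr_ge0.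
Qed.

(** Reversed Cauchy-Schwarz: combine [x] and [y] so that the time coordinates
    cancel. The result has nonnegative square, and in the expansion of that
    square the terms in [mink x x] and [mink y y] are negative, so the cross
    term, a negative multiple of [mink x y], is positive. *)
Lemma mink_future_lt0 {R : realType} {d : nat} (x y : 'rV[R]_d.+1) :
  future_timelike x -> future_timelike y -> mink x y < 0.
Proof.
move=> [xx x0] [yy y0].
set a := x ord0 ord_max in x0; set b := y ord0 ord_max in y0.
have /mink_ge0 : (b *: x + (- a) *: y) ord0 ord_max = 0.
  by rewrite !mxE -/a -/b; ring.
rewrite mink_sqr => h.
have : b ^+ 2 * mink x x < 0 by rewrite pmulr_rlt0// exprn_gt0.
have : (- a) ^+ 2 * mink y y < 0 by rewrite pmulr_rlt0// sqrrN exprn_gt0.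
move=> h1 h2; have : 2 * b * a * mink x y < 0 by lra.
by rewrite pmulr_rlt0// !mulr_gt0.
Qed.

(** In the square of [v + s *: e] the negative term [s ^+ 2 * mink e e] dominates
    for large [s], and in its time coordinate the contribution of [s *: e]
    does. *)
Lemma future_timelike_absorbing {R : realType} {d : nat} (e : 'rV[R]_d.+1) :
  future_timelike e -> absorbing_cone future_timelike e.
Proof.
move=> Fe; split=> // [c v c0 [vv v0]|u v Fu Fv|v].
- split; last by rewrite mxE mulr_gt0.
  have := mink_sqr c 0 v 0; rewrite scale0r addr0 => ->.
  have : c ^+ 2 * mink v v < 0 by rewrite pmulr_rlt0// exprn_gt0.
  lra.
- have := mink_future_lt0 _ _ Fu Fv; have := mink_sqr 1 1 u v.
  case: Fu => uu u0; case: Fv => vv v0; rewrite !scale1r => uvE uv.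
  by split; [rewrite uvE; lra|rewrite mxE addr_gt0].
case: Fe => ee e0.
pose q := - mink e e; have q0 : 0 < q by rewrite oppr_gt0.
pose A := `|mink v v| + 2 * `|mink v e|.
have A0 : 0 <= A by rewrite addr_ge0// mulr_ge0.
(* s >= 1 reduces the quadratic condition to A < s q; the last summand is for
   the time coordinate. *)
pose s := 1 + A / q + `|v ord0 ord_max| / e ord0 ord_max.
have A_q : 0 <= A / q by rewrite divr_ge0// ltW.
have v_e : 0 <= `|v ord0 ord_max| / e ord0 ord_max by rewrite divr_ge0// ltW.
have s1 : 1 <= s by rewrite /s; lra.
exists s; split.
  have := mink_sqr 1 s v e; rewrite scale1r => ->.
  have Asq : A < s * q.
    by rewrite -ltr_pdivrMr// /s; lra.
  have : s * A < s * (s * q) by rewrite ltr_pM2l//; lra.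
  have : mink v v <= s * `|mink v v|.
    by apply: le_trans (ler_norm _) _; rewrite ler_peMl.
  have : s * mink v e <= s * `|mink v e| by rewrite ler_wpM2l ?ler_norm//; lra.
  rewrite /A /q; nra.
rewrite !mxE.
have : `|v ord0 ord_max| < s * e ord0 ord_max.
  by rewrite -ltr_pdivrMr// /s; lra.
have := ler_norm (- v ord0 ord_max); rewrite normrN; lra.
Qed.

(** * Support points of a sublinear function *)

Lemma mink_represents {R : realType} {d : nat} (c : 'I_d.+1 -> R) :
  exists x : 'rV[R]_d.+1, forall v, mink x v = \sum_i v ord0 i * c i.
Proof.
exists (\row_i (if i == ord_max then - c i else c i)) => v.
rewrite /mink big_ord_recr /= !mxE eqxx; congr (_ + _); last by ring.
apply: eq_bigr => i _; rewrite mxE mulrC.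
case: eqP => // /(congr1 val)/= iE.
by have := ltn_ord i; rewrite iE ltnn.
Qed.

(** The linear form is chosen below the linearization of [H] along [e]; its value
    at [- e] is then at most [- H e], which forces equality at [e]. *)
Lemma support_point {R : realType} {d : nat} (H : 'rV[R]_d.+1 -> R)
    (e : 'rV[R]_d.+1) : sublinear_on_future H -> future_timelike e ->
  exists x, (forall eta, future_timelike eta -> mink x eta <= H eta) /\
            mink x e = H e.
Proof.
move=> slH Fe; have aF := future_timelike_absorbing _ Fe.
have slp := linearize_sublinear slH aF.
have [c cle] := hahn_banach_rV _ slp.
have [x xE] := mink_represents c.
have xle v : mink x v <= linearize future_timelike e H v by rewrite xE.
exists x; have xF eta : future_timelike eta -> mink x eta <= H eta.
  by move=> Feta; apply: le_trans (xle eta) _; exact: linearize_le_id.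
split=> //; apply/eqP; rewrite eq_le xF//=.
have := xle (- e); have := linearize_opp slH aF.
have := mink_linear 0 (-1) 0 e x; rewrite scale0r add0r scaleN1r !(minkC _ x).
lra.
Qed.

Lemma future_timelike_axis {R : realType} {d : nat} :
  future_timelike (delta_mx ord0 ord_max : 'rV[R]_d.+1).
Proof.
split; rewrite ?mxE ?eqxx//= /mink big1 ?mxE ?eqxx/=; first by lra.
move=> i _; rewrite !mxE eqxx /=.
case: eqP => [/(congr1 val)/= iE|]; last by rewrite mul0r.
by have := ltn_ord i; rewrite iE ltnn.
Qed.

Lemma closed_future_side {R : realType} {d : nat} (eta : 'rV[R]_d.+1) (a : R) :
  closed (future_side eta a).
Proof.
have -> : future_side eta a = (fun x => mink x eta) @^-1` [set t | t <= a] by [].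
apply: preimage_closed; last exact: closed_le.
have mxc (j : 'I_d.+1) :
    continuous (fun x : 'rV[R]_d.+1 => x ord0 j * eta ord0 j).
  move=> x; apply: continuousM; last exact: cst_continuous.
  exact: (@coord_continuous R 1 d.+1).
move=> x _; rewrite /mink; apply: (@continuousB _ _ _
  (fun x : 'rV[R]_d.+1 => \sum_(i < d) x ord0 (widen_ord (leqnSn d) i) *
     eta ord0 (widen_ord (leqnSn d) i))
  (fun x : 'rV[R]_d.+1 => x ord0 ord_max * eta ord0 ord_max)); last exact: mxc.
by apply: continuous_big => [|i _]; [exact: add_continuous|exact: mxc].
Qed.

Theorem lemma2p18 (R : realType) (d : nat) (hd : (1 <= d)%N)
    (H : 'rV[R]_d.+1 -> R) (hH : sublinear_on_future H) :
  let K : set 'rV[R]_d.+1 :=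
    [set x | forall eta, future_timelike eta -> mink x eta <= H eta] in
  F_convex K /\
  (forall eta, future_timelike eta -> H eta = ext_support K eta).
Proof.
move=> K; pose e0 : 'rV[R]_d.+1 := delta_mx ord0 ord_max.
have Fe0 : future_timelike e0 := future_timelike_axis.
have KE : K = \bigcap_(p in [set p | future_timelike p.1 /\ p.2 = H p.1])
                future_side p.1 p.2.
  apply/seteqP; split=> [x Kx [eta a] /= [Feta ->]|x Kx eta Feta]; first exact: Kx.
  exact: (Kx (eta, H eta)).
split; last first.
  move=> eta Feta; have [x [Kx xE]] := support_point _ _ hH Feta.
  have ubH : ubound [set mink k eta | k in K] (H eta).
    by move=> _ [k Kk <-]; exact: Kk.
  apply/eqP; rewrite eq_le; apply/andP; split.
    by rewrite -xE; apply: ub_le_sup; [exists (H eta)|exists x].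
  by apply: ge_sup => //; exists (H eta), x.
split.
- by have [x [Kx _]] := support_point _ _ hH Fe0; exists x.
(* On the time axis the form is negative definite, so a suitable multiple
   of e0 violates the constraint at e0. *)
- move=> KT; pose s := (H e0 + 1) / mink e0 e0.
  have : K (s *: e0) by rewrite KT.
  move=> /(_ e0 Fe0).
  have := mink_linear s 0 e0 0 e0; rewrite scale0r addr0 => ->.
  rewrite /s divfK ?(ltr0_neq0 Fe0.1)//; lra.
- rewrite KE; apply: closed_bigI => p _; exact: closed_future_side.
- move=> x y l; rewrite !inE => Kx Ky eta Feta.
  rewrite mink_linear.
  rewrite -[leRHS]mul1r -[1](subrKC l%:num) [leRHS]mulrDl.
  apply: lerD; apply: ler_wpM2l => //; [exact: Kx| |exact: Ky].
  by rewrite subr_ge0.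
- by exists [set p | future_timelike p.1 /\ p.2 = H p.1]; split=> // p [].
- by move=> eta Feta; exists (H eta) => k Kk; rewrite minkC; exact: Kk.
Qed.
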